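(* Let $G$ be a graph, let $\eta$ be an index function of $G$ with $\eta(e)=1$ for every edge $e\in E(G)$, and let $v$ be a vertex of $G$. Let $S$ be a set of exactly $d_G(v)-\eta(v)$ neighbours of $v$ such that $\eta(u)\ge 1$ for every $u\in S$ (so there remain exactly $\eta(v)$ neighbours of $v$ not in $S$). Let $\eta'$ be the index function of $G-v$ that equals the restriction of $\eta$ to $V(G-v)\cup E(G-v)$, except that $\eta'(u)=\eta(u)-1$ for each $u\in S$, and $\eta'(u)=\eta(u)+1$ for each neighbour $u$ of $v$ with $u\notin S$. If $\eta'$ is a non-singular index function of $G-v$, then $\eta$ is a non-singular index function of $G$.
   Context: Graphs are finite and simple; $d_G(v)$ is the degree of $v$, and $G-v$ is obtained from $G$ by deleting $v$ and all edges incident to $v$. The matrix $A_G$: fix an orientation of $G$. $A_G$ is the real matrix with rows indexed by $E(G)$ and columns indexed by $V(G)\cup E(G)$, where for an edge $e$ oriented from $a$ to $b$: $A_G[e,z]=1$ if $z=b$ or $z\neq e$ is an edge incident to $b$; $A_G[e,z]=-1$ if $z=a$ or $z\ne e$ is an edge incident to $a$; and $A_G[e,z]=0$ otherwise. (Changing the orientation only multiplies rows by $-1$, so the notions below do not depend on it.) $A_G(z)$ denotes the column indexed by $z$. An index function of $G$ is a mapping $\eta$ assigning to each $z\in V(G)\cup E(G)$ a non-negative integer $\eta(z)$. It is valid if $\sum_{z\in V(G)\cup E(G)}\eta(z)=|E(G)|$. $A_G(\eta)$ is the matrix whose columns are columns of $A_G$, with each column $A_G(z)$ occurring exactly $\eta(z)$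 times; for valid $\eta$ it is square. The permanent of an $m\times m$ matrix $A$ is $\mathrm{per}(A)=\sum_{\sigma\in S_m}\prod_{i=1}^m A[i,\sigma(i)]$ (the empty matrix has permanent $1$). An index function $\eta$ of $G$ is non-singular if there is a valid index function $\eta''\le\eta$ (pointwise) with $\mathrm{per}(A_G(\eta''))\neq 0$. *)

(* Defs.v *)
From HB Require Import structures.
From mathcomp Require Import all_boot all_order all_algebra all_fingroup.
From mathcomp Require Import reals.

Set Implicit Arguments.
Unset Strict Implicit.
Unset Printing Implicit Defensive.

Import Order.TTheory GRing.Theory Num.Theory.

Record sgraph := SGraph {
  svertex :> finType;
  adj : rel svertex;
  adj_sym : symmetric adj;
  adj_irrefl : irreflexive adj
}.

Section Graphs.
Variable G : sgraph.

Definition neighbours (v : G) : {set G} := [set u | adj v u].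

Definition deg (v : G) : nat := #|neighbours v|.

Definition edges : {set {set G}} :=
  [set [set p.1; p.2] | p : G * G & adj p.1 p.2].

Definition edge := {e : {set G} | e \in edges}.

(* V(G) + E(G), the set of column indices of A_G. *)
Definition item : finType := (G + edge)%type.

Record orientation := Orientation {
  tail : edge -> G;
  head : edge -> G;
  orientationP : forall e, val e = [set tail e; head e]
}.

Lemma orientation_exists : inhabited orientation.
Proof.
have H (e : edge) : exists p : G * G, val e == [set p.1; p.2].
  by case: e => e /= /imsetP[p _ ->]; exists p.
pose p e := xchoose (H e).
by exists; exists (fun e => (p e).1) (fun e => (p e).2) => e;
  apply/eqP/(xchooseP (H e)).
Qed.

(* The vertex x, or an edge other than e incident to x. *)
Definition meets_at (e : edge) (x : G) (z : item) : bool :=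
  match z with
  | inl u => u == x
  | inr f => (f != e) && (x \in val f)
  end.

(* No z meets e at both ends (G is simple), so the order of the tests is
   irrelevant. *)
Definition A_entry (R : realType) (o : orientation) (e : edge) (z : item) : R :=
  (if meets_at e (head o e) z then 1
   else if meets_at e (tail o e) z then -1
   else 0)%R.

Definition A_mx (R : realType) (o : orientation) : 'M[R]_(#|{: edge}|, #|item|) :=
  (\matrix_(i, j) A_entry R o (enum_val i) (enum_val j))%R.

Definition index_fun := item -> nat.

Definition valid (eta : index_fun) : Prop := \sum_(z : item) eta z = #|{: edge}|.

(* eta z copies of each z, indexing the columns of A_G(eta). *)
Definition copies (eta : index_fun) : finType := {z : item & 'I_(eta z)}.

Lemma card_copies (eta : index_fun) : #|copies eta| = \sum_(z : item) eta z.
Proof.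
rewrite card_tagged sumnE big_map big_enum.
by apply: eq_bigr => z _; rewrite card_ord.
Qed.

Definition A_cols (R : realType) (o : orientation) (eta : index_fun) :
    'M[R]_(#|{: edge}|, #|copies eta|) :=
  colsub (fun j => enum_rank (tag (enum_val j))) (A_mx R o).

Definition A_square (R : realType) (o : orientation) (eta : index_fun)
    (h : valid eta) : 'M[R]_#|{: edge}| :=
  castmx (erefl, etrans (card_copies eta) h) (A_cols R o eta).

End Graphs.

Definition permanent (R : pzSemiRingType) (n : nat) (A : 'M[R]_n) : R :=
  (\sum_(s : 'S_n) \prod_(i < n) A i (s i))%R.

Definition nonsingular (R : realType) (G : sgraph) (o : orientation G)
    (eta : index_fun G) : Prop :=
  exists (eta'' : index_fun G) (h : valid eta''),
    (forall z, eta'' z <= eta z) /\ permanent (A_square R o h) <> 0%R.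

Section Deletion.
Variables (G : sgraph) (v : G).

Definition del_vertex : sgraph :=
  @SGraph {x : G | x != v} (fun x y => adj (val x) (val y))
    (fun x y => adj_sym (val x) (val y)) (fun x => adj_irrefl (val x)).

Lemma lift_edge_subproof (f : edge del_vertex) :
  [set (val x : G) | x in val f] \in edges G.
Proof.
case: f => f /= /imsetP[[x y] /= xy ->]; rewrite imsetU1 imset_set1.
by rewrite inE in xy; apply/imsetP; exists (val x, val y); rewrite ?inE.
Qed.

(* The inclusion of E(G - v) in E(G). *)
Definition lift_edge (f : edge del_vertex) : edge G :=
  exist (fun e => e \in edges G) _ (lift_edge_subproof f).

Definition eta_del (eta : index_fun G) (S : {set G}) : index_fun del_vertex :=
  fun z => match z with
  | inl u => if val u \in S then eta (inl (val u)) - 1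
             else if val u \in neighbours v then eta (inl (val u)) + 1
             else eta (inl (val u))
  | inr f => eta (inr (lift_edge f))
  end.

End Deletion.

(* Main.v *)
(* If e = uv then A_G(e) = A_G(u) + A_G(v) as columns.  Let s be a list of
   columns of A_{G-v}, with multiplicities at most eta', whose square matrix has
   nonzero permanent.  Column v of A_G is supported on the d = d(v) rows of the
   edges at v, so adding d copies of column v to s multiplies the permanent by
   d! up to sign.  For each neighbour u of v outside S, replace a copy of u, if
   there is one, by A_G(uv) - A_G(v): terms with d + 1 copies of v vanish, so
   the permanent with uv in place of u is unchanged.  Finally replace |S| of the
   copies of v by A_G(uv) - A_G(u), one for each u in S: some term of the
   expansion is nonzero, and its multiplicities are at most eta. *)

Require Import Defs.
From mathcomp Require Import all_boot all_order all_algebra reals.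
From mathcomp Require Import fingroup perm zify.

Set Implicit Arguments.
Unset Strict Implicit.
Unset Printing Implicit Defensive.

Import Defs GRing.Theory Num.Theory.

(** * Permanents as functions of a list of columns and a set of rows *)

Section SeqPermanent.
Local Open Scope ring_scope.
Variable R : comNzRingType.

(* Laplace expansion along the columns: the permanent of the matrix with rows D
   and columns listed by s, or 0 when it is not square. *)
Fixpoint sper (E : finType) (I : Type) (M : E -> I -> R) (s : seq I)
    (D : {set E}) : R :=
  if s is z :: s' then \sum_(e in D) M e z * sper M s' (D :\ e)
  else (D == set0)%:R.

Lemma sper_map (E : finType) (I J : Type) (M : E -> I -> R) (g : J -> I) s D :
  sper M (map g s) D = sper (fun e j => M e (g j)) s D.
Proof.
by elim: s D => //= z s IHs D; apply: eq_bigr => e _; rewrite IHs.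
Qed.

(** Renaming of rows; it serves both to index edges by ordinals and to view the edges of [G - v] as
    edges of [G]. *)
Lemma sper_imset (E F : finType) (I : Type) (h : F -> E) (M : E -> I -> R)
    s (D : {set F}) :
  injective h -> sper M s (h @: D) = sper (fun f => M (h f)) s D.
Proof.
move=> h_inj; elim: s D => [|z s IHs] D /=; first by rewrite imset_eq0.
rewrite big_imset /=; last by move=> x y _ _; apply: h_inj.
apply: eq_bigr => f _; rewrite -IHs; congr (_ * sper _ _ _).
apply/setP=> e; rewrite !inE; apply/andP/imsetP => [[ne /imsetP[g gD eg]]|[g]].
  by exists g => //; rewrite !inE gD andbT;
  apply: contraNneq ne => <-; rewrite eg.
rewrite !inE => /andP[gf gD] ->; split; last exact: imset_f.
by apply: contraNneq gf => /h_inj ->.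
Qed.

(** Every term uses each row exactly once. The factors [c] will be the signs by which two
    orientations differ. *)
Lemma sper_scale (E : finType) (I : Type) (M M' : E -> I -> R) (c : E -> R)
    s (D : {set E}) :
  (forall e z, M' e z = c e * M e z) ->
  sper M' s D = (\prod_(e in D) c e) * sper M s D.
Proof.
move=> MM'; elim: s D => [|z s IHs] D /=.
  by case: eqP => [->|_]; rewrite ?mulr0 // big_set0 mulr1.
rewrite mulr_sumr; apply: eq_bigr => e eD.
by rewrite MM' IHs [in RHS](big_setD1 e) //= !mulrA; congr (_ * _);
  rewrite -!mulrA; congr (_ * _); rewrite mulrC.
Qed.

(** Both sides are sums over ordered pairs of distinct rows, one matched with [x] and one with
    [y]. *)
Lemma sper_swap (E : finType) (I : Type) (M : E -> I -> R) x y s D :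
  sper M (x :: y :: s) D = sper M (y :: x :: s) D.
Proof.
rewrite /=; under eq_bigr do rewrite mulr_sumr.
under [RHS]eq_bigr do rewrite mulr_sumr.
rewrite (exchange_big_dep (mem D)) /=; last by move=> e f _ /setD1P[].
apply: eq_bigr => f fD; apply: eq_big => [e|e _].
  by rewrite !inE fD eq_sym andbT andbC.
by rewrite mulrCA; congr (_ * (_ * sper _ _ _));
  apply/setP=> g; rewrite !inE andbCA.
Qed.

Lemma sper_cons_eq (E : finType) (I : Type) (M : E -> I -> R) x s t :
  sper M s =1 sper M t -> sper M (x :: s) =1 sper M (x :: t).
Proof. by move=> st D /=; apply: eq_bigr => e _; rewrite st. Qed.

Lemma sper_catCcons (E : finType) (I : Type) (M : E -> I -> R) x s t D :
  sper M (s ++ x :: t) D = sper M (x :: s ++ t) D.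
Proof.
elim: s D => // y s IHs D; rewrite [RHS]sper_swap; exact: sper_cons_eq.
Qed.

Lemma sper_perm (E : finType) (I : eqType) (M : E -> I -> R) s t :
  perm_eq s t -> sper M s =1 sper M t.
Proof.
elim: s t => [|x s IHs] t; first by move/perm_size/esym/size0nil=> ->.
move=> xst D; have xt: x \in t by rewrite -(perm_mem xst) mem_head.
case/splitPr: t / xt xst => t1 t2; rewrite perm_sym perm_catC /=.
rewrite perm_cons perm_sym => st; rewrite sper_catCcons.
apply: sper_cons_eq; apply: IHs; rewrite (perm_trans st) //.
by rewrite perm_catC.
Qed.

Lemma sper_size (E : finType) (I : Type) (M : E -> I -> R) s (D : {set E}) :
  sper M s D != 0 -> size s = #|D|.
Proof.
elim: s D => [|x s IHs] D /=.
  by case: (D =P set0) => [->|_]; rewrite ?cards0 ?eqxx.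
apply: contraNeq => neq; rewrite big1 // => e eD.
have [->|/IHs sz] := eqVneq (sper M s (D :\ e)) 0; first by rewrite mulr0.
by rewrite sz (cardsD1 e D) eD eqxx in neq.
Qed.

Lemma sper_consB (E : finType) (I : Type) (M : E -> I -> R) x y z s D :
  (forall e, M e z = M e x - M e y) ->
  sper M (z :: s) D = sper M (x :: s) D - sper M (y :: s) D.
Proof.
by move=> Mz; rewrite /= -sumrB; apply: eq_bigr => e _; rewrite Mz mulrBl.
Qed.

(* The permanent of a block triangular matrix, one of whose diagonal blocks
   consists of equal columns. *)
Lemma sper_nseq_cat (E : finType) (I : Type) (M : E -> I -> R) v s
    (B D : {set E}) :
  (forall e, e \notin B -> M e v = 0) ->
  sper M (nseq #|D :&: B| v ++ s) D =
    (#|D :&: B|)`!%:R * (\prod_(e in D :&: B) M e v) * sper M s (D :\: B).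
Proof.
move=> Mv0; move Ek: #|D :&: B| => k; elim: k D Ek => [|k IHk] D Ek.
  move/eqP: Ek; rewrite cards_eq0 => /eqP DB0.
  by rewrite DB0 big_set0 !mul1r -[D in LHS](setID D B) DB0 set0U.
rewrite /= (bigID (mem B)) /= [X in _ + X]big1 ?addr0; last first.
  by move=> e /andP[_ /Mv0->]; rewrite mul0r.
(* The summand does not depend on the row [e] chosen for the first copy of [v], so the [k.+1]
   choices turn [k!] into [k.+1!]. *)
rewrite (eq_bigr (fun=> k`!%:R * (\prod_(e in D :&: B) M e v) *
   sper M s (D :\: B))); last first.
  move=> e /andP[eD eB].
  have DBe: (D :\ e) :&: B = (D :&: B) :\ e.
    by apply/setP=> f; rewrite !inE andbA.
  have eDB: e \in D :&: B by rewrite inE eD.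
  rewrite IHk DBe; last by move: Ek; rewrite (cardsD1 e) eDB => -[].
  have ->: (D :\ e) :\: B = D :\: B.
    by apply/setP=> f; rewrite !inE; case: eqP => [->|//]; rewrite eB.
  by rewrite [in RHS](big_setD1 e) //= !mulrA; congr (_ * _ * _); rewrite mulrC.
rewrite (eq_bigl (mem (D :&: B))) => [|e]; last by rewrite !inE.
by rewrite sumr_const Ek factS natrM -!mulrA -[LHS]mulr_natl.
Qed.

(** Some copy of [v] must be matched with a row outside [B], where its entry is zero. *)
Lemma sper_nseq_eq0 (E : finType) (I : Type) (M : E -> I -> R) v s
    (B D : {set E}) k :
  (forall e, e \notin B -> M e v = 0) -> (#|D :&: B| < k)%N ->
  sper M (nseq k v ++ s) D = 0.
Proof.
move=> Mv0; elim: k D => // k IHk D ltk /=; apply: big1 => e eD.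
have [eB|/Mv0->] := boolP (e \in B); last by rewrite mul0r.
rewrite IHk ?mulr0 //; move: ltk; rewrite (cardsD1 e) inE eD eB add1n ltnS.
by rewrite setIDAC.
Qed.

Lemma sper_permutations (E : finType) (I : Type) (M : E -> I -> R) s es :
  uniq es -> size s = size es ->
  sper M s [set e in es] =
    \sum_(t <- permutations es) \prod_(p <- zip s t) M p.2 p.1.
Proof.
elim: s es => [|z s IHs] es Ues.
  move/esym/size0nil => ->; rewrite (_ : permutations [::] = [:: [::]]) //.
  rewrite big_seq1 big_nil /=.
  by rewrite (_ : [set e in [::]] = set0 :> {set E}) ?eqxx //;
    apply/setP=> e; rewrite !inE.
move=> /= sz; have es_gt0 : (0 < size es)%N by rewrite -sz.
rewrite (perm_big _ (permutationsE es_gt0)) /= big_allpairs_dep /= undup_id //.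
under eq_bigl do rewrite inE.
rewrite -big_uniq //= !big_seq; apply: eq_bigr => e ees.
under eq_bigr do rewrite big_cons.
rewrite -mulr_sumr -IHs ?rem_uniq ?size_rem -?sz //.
by congr (_ * sper _ _ _); apply/setP=> f; rewrite !inE mem_rem_uniq.
Qed.

Lemma permanent_sper n (A : 'M[R]_n) :
  permanent A = sper A (enum 'I_n) [set: 'I_n].
Proof.
have -> : [set: 'I_n] = [set i in enum 'I_n].
  by apply/setP=> i; rewrite !inE mem_enum.
rewrite sper_permutations ?enum_uniq //.
pose f (s : 'S_n) := [seq s i | i <- enum 'I_n].
have f_inj : injective f.
  by move=> s t /eq_in_map st; apply/permP=> i; apply: st; rewrite mem_enum.
have fP : perm_eq (map f (enum 'S_n)) (permutations (enum 'I_n)).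
  have Uf : uniq (map f (enum 'S_n)) by rewrite map_inj_uniq ?enum_uniq.
  (* Both lists have [n!] entries and the first has no repetition, so one inclusion suffices. *)
  have [||_] := uniq_min_size Uf (s2 := permutations (enum 'I_n)).
  - move=> _ /mapP[s _ ->]; rewrite mem_permutations; apply: uniq_perm.
    + by rewrite map_inj_uniq ?enum_uniq //; apply: perm_inj.
    + exact: enum_uniq.
    + move=> i; rewrite mem_enum; apply/mapP; exists ((s^-1)%g i) => //.
        by rewrite mem_enum.
      by rewrite permKV.
  - rewrite size_map size_permutations ?enum_uniq // size_enum_ord -cardE.
    by rewrite card_Sn.
  - by move=> Ef; apply: uniq_perm; rewrite ?permutations_uniq.
(* [permanent] sends rows to columns while [zip] sends columns to rows, hence the passage to
   inverses. *)
rewrite -(perm_big _ fP) /= big_map big_enum /= [LHS](reindex_inj invg_inj) /=.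
apply: eq_bigr => s _; rewrite -[enum 'I_n in X in zip X _]map_id zip_map.
rewrite big_map big_enum /= [LHS](reindex_inj (@perm_inj _ s)).
by apply: eq_bigr => i _; rewrite permK.
Qed.

End SeqPermanent.

(** * Exchanging columns along linear relations *)

Section Exchange.
Local Open Scope ring_scope.
Variables (R : comNzRingType) (E : finType) (I : eqType) (M : E -> I -> R).
Variables (J : eqType) (x y : J -> I) (v : I).
Variable D : {set E}.

(* Writing x_j = y_j - v, the terms of the expansion that contain v vanish, as
   they have more copies of v than v has nonzero entries. *)
Lemma sper_exchange_right (B : {set E}) (T : seq J) (s : seq I) :
  (forall e, e \notin B -> M e v = 0) ->
  (forall j e, j \in T -> M e (x j) = M e (y j) - M e v) ->
  sper M (nseq #|D :&: B| v ++ s) D != 0 ->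
  exists2 s', sper M (nseq #|D :&: B| v ++ s') D != 0 &
    forall z, (count_mem z s' <=
      count_mem z s - count_mem z (map x T) + count_mem z (map y T))%N.
Proof.
move=> Mv0; elim: T => [|j T IHT] Mxy nz.
  by exists s => // z; rewrite subn0 addn0.
have {IHT}[|s' nz' cnt] := IHT _ nz.
  by move=> i e iT; rewrite Mxy // in_cons iT orbT.
(* If [x j] does not occur, [s'] is kept: its count at [x j] is 0, so the truncated subtraction in
   the bound is harmless. *)
have [xs'|xs'] := boolP (x j \in s'); last first.
  exists s' => // z /=; have := cnt z.
  have [<-|_] := eqVneq (x j) z; last by lia.
  by move/count_memPn: xs' => ->.
exists (y j :: rem (x j) s').
  apply: contraNneq nz' => nz'.
  have /(sper_perm M)-> : perm_eq (nseq #|D :&: B| v ++ s')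
      (x j :: nseq #|D :&: B| v ++ rem (x j) s').
    rewrite perm_sym -cat1s perm_catCA perm_cat2l perm_sym.
    exact: perm_to_rem.
  rewrite (sper_consB (x := y j) (y := v)); last first.
    by move=> e; rewrite Mxy ?mem_head.
  rewrite -[v :: _ ++ rem (x j) s']/(nseq #|D :&: B|.+1 v ++ rem (x j) s').
  rewrite (sper_nseq_eq0 _ Mv0) ?leqnn // subr0.
  by rewrite -sper_catCcons nz'.
move=> z /=; have := cnt z; rewrite count_rem xs' /=.
by case: (x j == z); case: (y j == z); lia.
Qed.

(** Replacing one copy of [v] by [y j - x j] gives a difference of two permanents, which cannot both
    vanish. Which one survives is unknown, so the bound allows for both [x j] and [y j]. *)
Lemma sper_exchange_left (T : seq J) (s : seq I) :
  (forall j e, j \in T -> M e v = M e (y j) - M e (x j)) ->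
  sper M (nseq (size T) v ++ s) D != 0 ->
  exists2 s', sper M s' D != 0 &
    forall z, (count_mem z s' <=
      count_mem z s + count_mem z (map x T) + count_mem z (map y T))%N.
Proof.
elim: T s => [|j T IHT] s Mv nz.
  by exists s => // z; rewrite !addn0.
have [w wP nzw] : exists2 w, w = x j \/ w = y j &
    sper M (nseq (size T) v ++ w :: s) D != 0.
  move: nz; rewrite -[_ ++ s]/(v :: nseq (size T) v ++ s).
  rewrite (sper_consB (x := y j) (y := x j)); last first.
    by move=> e; rewrite (Mv j) ?mem_head.
  rewrite -!sper_catCcons.
  have [->|] := eqVneq (sper M (nseq (size T) v ++ x j :: s) D) 0.
    by rewrite subr0; exists (y j) => //; right.
  by exists (x j) => //; left.
have [|s' nz' cnt] := IHT _ _ nzw.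
  by move=> i e iT; rewrite (Mv i) // in_cons iT orbT.
exists s' => // z; apply: leq_trans (cnt z) _ => /=.
by case: wP => ->; case: (x j == z); case: (y j == z); lia.
Qed.

End Exchange.

(** * Non-singularity in terms of lists of columns *)

Section Nonsingular.
Local Open Scope ring_scope.
Variables (R : realType) (G : sgraph) (o : orientation G).

Lemma count_copies (eta : index_fun G) z :
  count_mem z [seq tag c | c : copies eta] = eta z.
Proof.
rewrite count_map -sum1_count big_enum_cond /=.
rewrite (eq_bigl (fun c : copies eta => (tag c == z) && true)); last first.
  by move=> c; rewrite andbT.
rewrite -(sig_big_dep (fun z' => z' == z)
  (fun _ _ => true) (fun _ _ => 1%N)) /=.
by rewrite big_pred1_eq sum1_card card_ord.
Qed.

Lemma permanent_A_square (eta : index_fun G) (h : valid eta) :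
  permanent (A_square R o h) =
    sper (A_entry R o) [seq tag c | c : copies eta] [set: edge G].
Proof.
(* Stated for arbitrary [m] and [n] so that the equality can be destructed and the cast
   disappears. *)
have perm_cast m n (e : m = n) (B : 'M[R]_(n, m)) :
    permanent (castmx (erefl n, e) B) = sper B (enum 'I_m) [set: 'I_n].
  by case: n / e B => B; rewrite castmx_id permanent_sper.
rewrite perm_cast /image_mem.
have -> : [set: edge G] = (@enum_val _ (mem {: edge G})) @: setT.
  apply/setP=> e; rewrite inE; apply/esym/imsetP.
  by exists (enum_rank e); rewrite ?enum_rankK.
rewrite sper_imset; last exact: enum_val_inj.
have enumP : perm_eq (enum (copies eta))
    [seq enum_val j | j <- enum 'I_#|copies eta|].
  apply: uniq_perm; first exact: enum_uniq.
    by rewrite map_inj_uniq ?enum_uniq //; apply: enum_val_inj.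
  move=> c; rewrite mem_enum; apply/esym/mapP; exists (enum_rank c).
    by rewrite mem_enum.
  by rewrite enum_rankK.
rewrite (sper_perm _ (perm_map (@tag _ _) enumP)) -map_comp sper_map.
congr sper; apply: boolp.funext => i; apply: boolp.funext => j.
by rewrite !mxE /= enum_rankK.
Qed.

Lemma nonsingularP (eta : index_fun G) :
  nonsingular R o eta <->
  exists2 s : seq (item G), (forall z, (count_mem z s <= eta z)%N) &
    sper (A_entry R o) s setT != 0.
Proof.
split=> [[eta'' [h [le_eta /eqP]]]|[s le_eta nz]].
  rewrite permanent_A_square => nz.
  exists [seq tag c | c : copies eta''] => // z.
  by rewrite count_copies.
(* Validity comes for free: a nonzero [sper] forces as many columns as rows. *)
have h : valid (fun z => count_mem z s).
  rewrite /valid -cardsT -(sper_size nz).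
  under eq_bigr do rewrite -sum1_count big_mkcond.
  rewrite exchange_big -sum1_size /=; apply: eq_bigr => x _.
  by rewrite -big_mkcond (big_pred1 x) // => z; rewrite eq_sym.
exists (fun z => count_mem z s), h; split=> //; apply/eqP.
rewrite permanent_A_square (sper_perm _ (t := s)) //.
by apply/allP=> z _; rewrite /= count_copies.
Qed.

End Nonsingular.

(** * Entries of [A_G] and the relation between an edge column and its end columns *)

Section Columns.
Local Open Scope ring_scope.
Variables (R : realType) (G : sgraph) (o : orientation G).

Lemma card_edge (e : edge G) : #|val e| = 2.
Proof.
have /imsetP[[x y] /=] := valP e; rewrite inE /= => xy ->.
by rewrite cards2; case: eqP xy => // ->; rewrite adj_irrefl.
Qed.

Lemma edge_eq2 (e : edge G) a b :
  a != b -> a \in val e -> b \in val e -> val e = [set a; b].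
Proof.
move=> ab ae be; apply/esym/eqP.
by rewrite eqEcard card_edge cards2 ab andbT subUset !sub1set ae.
Qed.

Lemma head_neq_tail e : head o e != tail o e.
Proof.
apply/eqP => ht; have := card_edge e.
by rewrite (orientationP o) ht setUid cards1.
Qed.

Lemma A_entry_vertex_eq0 e u : (A_entry R o e (inl u) == 0) = (u \notin val e).
Proof.
rewrite (orientationP o) !inE /A_entry /= negb_or.
case: (u == head o e); rewrite ?oner_eq0 ?andbF //.
by case: (u == tail o e); rewrite ?oppr_eq0 ?oner_eq0 ?eqxx.
Qed.

(** In row [f] itself the two ends contribute 1 and -1, which cancel. In any other row [e], the
    edges [e] and [f] share at most one end, so at most one summand is nonzero. *)
Lemma A_entry_edge e f u v : val f = [set u; v] ->
  A_entry R o e (inr f) = A_entry R o e (inl u) + A_entry R o e (inl v).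
Proof.
move=> fP; have uv : u != v.
  by apply/eqP => uv; have := card_edge f; rewrite fP uv setUid cards1.
have ht := head_neq_tail e.
rewrite /A_entry /= fP !inE; have [fe|fe] := eqVneq f e.
  subst f; move: fP; rewrite (orientationP o) => eP /=.
  have : u \in [set tail o e; head o e] by rewrite eP !inE eqxx.
  have : v \in [set tail o e; head o e] by rewrite eP !inE eqxx orbT.
  rewrite !inE => /orP[]/eqP vE /orP[]/eqP uE; move: uv; rewrite uE vE ?eqxx //.
    by rewrite eq_sym => /negPf ->; rewrite subrr.
  by move=> /negPf->; rewrite addNr.
rewrite ![head o e == _]eq_sym ![tail o e == _]eq_sym /=.
have nuv : ~ ([set tail o e; head o e] = [set u; v]).
  by rewrite -fP -(orientationP o) => /val_inj ef; rewrite ef eqxx in fe.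
have [uh|uh] := eqVneq u (head o e); have [vh|vh] := eqVneq v (head o e) => /=.
- by rewrite uh vh eqxx in uv.
- case: eqVneq => [vt|_]; last by rewrite addr0.
  by case: nuv; rewrite uh vt setUC.
- case: eqVneq => [ut|_]; last by rewrite add0r.
  by case: nuv; rewrite vh ut.
have [ut|ut] := eqVneq u (tail o e); have [vt|vt] := eqVneq v (tail o e) => /=.
- by rewrite ut vt eqxx in uv.
- by rewrite addr0.
- by rewrite add0r.
by rewrite addr0.
Qed.

End Columns.

(** * Comparison of [G - v] with [G], and the edges at [v] *)

Section Deletion.
Local Open Scope ring_scope.
Variables (R : realType) (G : sgraph) (v : G).
Variables (o : orientation G) (o' : orientation (del_vertex v)).

Definition lift_item (z : item (del_vertex v)) : item G :=
  match z with inl u => inl (val u) | inr f => inr (lift_edge f) end.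

Lemma lift_edge_inj : injective (@lift_edge G v).
Proof.
move=> f g /(congr1 val) /= fg; apply: val_inj.
exact: imset_inj val_inj _ _ fg.
Qed.

Lemma lift_item_inj : injective lift_item.
Proof.
case=> [u|f] [w|g] // E; congr (_ _).
  by apply: val_inj; case: E.
by apply: lift_edge_inj; apply: val_inj; case: E.
Qed.

Lemma meets_at_lift f x z :
  meets_at (lift_edge f) (val x) (lift_item z) = meets_at f x z.
Proof.
case: z => [u|g] /=; first by rewrite val_eqE.
rewrite -(inj_eq lift_edge_inj) mem_imset //; exact: val_inj.
Qed.

Lemma A_entry_lift f z :
  A_entry R o (lift_edge f) (lift_item z) =
    (-1) ^+ (head o (lift_edge f) != val (head o' f)) * A_entry R o' f z.
Proof.
have ht := head_neq_tail o' f.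
(* Needed when the orientations disagree: the two tests in [A_entry] are then made in the opposite
   order. *)
have dis : ~~ (meets_at f (head o' f) z && meets_at f (tail o' f) z).
  case: z => [u|g] /=.
    by apply: contraNN ht => /andP[/eqP<- /eqP<-].
  apply/negP => /andP[/andP[gf hg] /andP[_ tg]].
  case/eqP: gf; apply: val_inj.
  by rewrite (edge_eq2 ht hg tg) (orientationP o') setUC.
have fE : val (lift_edge f) = [set val (tail o' f); val (head o' f)].
  by rewrite /= (orientationP o') imsetU1 imset_set1.
rewrite /A_entry; set h := val (head o' f) in fE *.
set t := val (tail o' f) in fE.
have {}ht : h != t by rewrite val_eqE.
have := head_neq_tail o (lift_edge f).
have : head o (lift_edge f) \in [set t; h].
  by rewrite -fE (orientationP o) !inE eqxx orbT.
have : tail o (lift_edge f) \in [set t; h].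
  by rewrite -fE (orientationP o) !inE eqxx.
rewrite !inE => /orP[]/eqP-> /orP[]/eqP->; rewrite ?eqxx // => _.
  by rewrite expr0 mul1r !meets_at_lift.
rewrite [t == h]eq_sym ht expr1 !meets_at_lift; move: dis.
by case: (meets_at f _ z) => /=; case: meets_at => //=;
  rewrite mulN1r ?opprK ?oppr0.
Qed.

(** Identifies the rows that remain once the copies of column [v] have used up the rows at [v]. *)
Lemma mem_lift_edge (e : edge G) :
  (e \in @lift_edge G v @: setT) = (v \notin val e).
Proof.
apply/imsetP/idP => [[f _ ->] /=|ve].
  by apply/imsetP => -[u _ vu]; have := valP u; rewrite /= -vu eqxx.
have /imsetP[[x y]] := valP e.
rewrite inE /= => xy eP; have := ve.
rewrite [val e]eP !inE negb_or ![v == _]eq_sym.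
case/andP=> xv yv.
have fP : [set exist _ x xv; exist _ y yv] \in edges (del_vertex v).
  by apply/imsetP; exists (exist _ x xv, exist _ y yv); rewrite ?inE.
exists (exist (fun f => f \in edges _) _ fP) => //; apply: val_inj.
by rewrite /= eP imsetU1 imset_set1.
Qed.

(* The column index of the edge uv, with junk value u when u is not adjacent
   to v. *)
Definition star_item (u : G) : item G :=
  oapp inr (inl u) (insub [set u; v] : option (edge G)).

Lemma star_itemP u : u \in neighbours v ->
  exists2 f : edge G, star_item u = inr f & val f = [set u; v].
Proof.
rewrite inE => vu; have uvE : [set u; v] \in edges G.
  by apply/imsetP; exists (u, v); rewrite // inE adj_sym.
by exists (Sub [set u; v] uvE); rewrite /star_item ?insubT ?SubK.
Qed.

Lemma star_item_inj : {in neighbours v &, injective star_item}.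
Proof.
move=> u w uN wN; have [f -> fP] := star_itemP uN.
have [g -> gP] := star_itemP wN.
move=> [] fg; move: fP; rewrite fg gP => /setP/(_ u); rewrite !inE eqxx /=.
case/orP=> [/eqP //|/eqP uv]; move: uN; by rewrite uv inE adj_irrefl.
Qed.

Lemma card_star : #|[set e : edge G | v \in val e]| = deg v.
Proof.
rewrite -(card_imset _ val_inj).
have star_inj : {in neighbours v &, injective (fun u : G => [set u; v])}.
  move=> u w; rewrite !inE => vu vw /setP/(_ u); rewrite !inE eqxx /=.
  by case/esym/orP=> /eqP // uv; move: vu; rewrite uv adj_irrefl.
rewrite /deg -(card_in_imset star_inj); apply: eq_card => e.
apply/imsetP/imsetP => [[f fv ->]|[u uN ->]].
  rewrite inE in fv; have /imsetP[[x y] /=] := valP f; rewrite inE /= => xy fE.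
  move: fv; rewrite [val f]fE !inE => /orP[]/eqP vE.
    by exists y; rewrite ?inE vE // setUC.
  by exists x; rewrite ?inE vE // adj_sym.
by have [f _ fE] := star_itemP uN; exists f; rewrite // inE fE !inE eqxx orbT.
Qed.

End Deletion.

(** * Passing from [G - v] to [G] *)

Lemma sper_star (R : realType) (G : sgraph) (v : G) (o : orientation G)
  (o' : orientation (del_vertex v)) (s : seq (item (del_vertex v))) :
  sper (A_entry R o') s setT != 0%R ->
  sper (A_entry R o) (nseq (deg v) (inl v) ++ map (@lift_item G v) s) setT
    != 0%R.
Proof.
move=> nz; pose B := [set e : edge G | v \in val e].
rewrite -card_star -/B -(setTI B) sper_nseq_cat; last first.
  by move=> e; rewrite inE -(A_entry_vertex_eq0 R o) => /eqP.
have -> : setT :\: B = @lift_edge G v @: setT.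
  by apply/setP=> e; rewrite mem_lift_edge !inE andbT.
rewrite sper_imset ?sper_map; last exact: lift_edge_inj.
rewrite (sper_scale _ _ (A_entry_lift R o o')).
(* The factorial is nonzero because the characteristic is zero; the other factors are entries of
   column [v] at edges through [v], and signs. *)
rewrite !mulf_neq0 ?pnatr_eq0 -?lt0n ?fact_gt0 //.
  by apply/prodf_neq0 => e; rewrite !inE A_entry_vertex_eq0 negbK.
by apply/prodf_neq0 => f _; rewrite signr_eq0.
Qed.

(** Distinct neighbours give distinct edges at [v], so no edge is introduced beyond its allowance of
    1. *)
Lemma count_star_item (G : sgraph) (v : G) (us : seq G) z :
  uniq us -> {subset us <= neighbours v} ->
  count_mem z (map (star_item v) us) <=
    (if z is inr e then v \in val e else false).
Proof.
move=> Uus us_v; rewrite count_uniq_mem; last first.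
  by rewrite map_inj_in_uniq // => u w /us_v uN /us_v wN; apply: star_item_inj.
have [/mapP[u /us_v/star_itemP[e -> eE] ->]|//] := boolP (_ \in _).
by rewrite eE !inE eqxx orbT.
Qed.

Theorem theorem1 (R : realType) (G : sgraph) (eta : index_fun G)
  (eta_edge : forall e : edge G, eta (inr e) = 1)
  (v : G) (S : {set G})
  (S_nbr : S \subset neighbours v)
  (eta_v_le : eta (inl v) <= deg v)
  (card_S : #|S| = deg v - eta (inl v))
  (eta_S : forall u : G, u \in S -> 1 <= eta (inl u))
  (o : orientation G) (o' : orientation (del_vertex v)) :
  nonsingular R o' (eta_del eta S) -> nonsingular R o eta.
Proof.
case/nonsingularP=> s le_s /(sper_star o) nz; apply/nonsingularP.
pose B := [set e : edge G | v \in val e].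
have Bv e : e \notin B -> A_entry R o e (inl v) = 0%R.
  by rewrite inE -(A_entry_vertex_eq0 R o) => /eqP.
have cardB : #|setT :&: B| = deg v by rewrite setTI card_star.
have star e u : u \in neighbours v ->
    A_entry R o e (star_item v u) =
      (A_entry R o e (inl u) + A_entry R o e (inl v))%R.
  by case/star_itemP=> f -> fE; rewrite (A_entry_edge _ _ _ fE).
rewrite -cardB in nz.
have [|s1 nz1 cnt1] := sper_exchange_right (x := inl) (y := star_item v)
    (T := enum (neighbours v :\: S)) Bv _ nz.
  by move=> u e; rewrite mem_enum !inE => /andP[_ uv];
    rewrite star ?inE // addrK.
have degE : deg v = #|S| + eta (inl v) by rewrite card_S subnK.
(* Of the [deg v] copies of [v], [#|S|] are to be exchanged and [eta (inl v)] are kept. *)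
rewrite cardB degE nseqD -catA cardE in nz1.
have [|s2 nz2 cnt2] := sper_exchange_left (x := inl) (y := star_item v)
    (T := enum S) _ nz1.
  by move=> u e; rewrite mem_enum => /(subsetP S_nbr) uv;
    rewrite star // addrC addKr.
exists s2 => // z; apply: leq_trans (cnt2 z) _.
pose us := enum (neighbours v :\: S) ++ enum S.
(* The two exchanges run over disjoint sets of neighbours, so together they still use each edge at
   [v] at most once. *)
have cstar : count_mem z (map (star_item v) us) <=
    (if z is inr e then v \in val e else false).
  apply: count_star_item.
    rewrite cat_uniq !enum_uniq andbT; apply/hasPn => u.
    by rewrite !mem_enum !inE => ->.
  move=> u; rewrite mem_cat !mem_enum => /orP[/setDP[]//|].
  exact: (subsetP S_nbr).
rewrite map_cat count_cat in cstar; move: (cnt1 z) cstar.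
have countE (N : {set G}) (y : item G) :
    count_mem y (map inl (enum N)) = (if y is inl u then u \in N else false).
  rewrite count_uniq_mem ?map_inj_uniq ?enum_uniq //; last by move=> ? ? [].
  case: y => [u|e]; last by apply/eqP; rewrite eqb0; apply/mapP => -[].
  by rewrite mem_map ?mem_enum // => ? ? [].
rewrite !countE count_cat count_nseq.
(* This is [eta_del] read in [G], with 0 at [v] and at the edges through [v], which no item of
   [G - v] reaches. *)
have : count_mem z (map (@lift_item G v) s) <= match z with
    | inl u => if u == v then 0 else if u \in S then eta (inl u) - 1
               else if u \in neighbours v then eta (inl u) + 1 else eta (inl u)
    | inr e => v \notin val e
    end.
  have [/mapP[z' _ ->]|/count_memPn->//] :=
    boolP (z \in map (@lift_item G v) s).
  rewrite count_map; apply: (@leq_trans (count_mem z' s)).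
    by apply: sub_count => y /=; rewrite (inj_eq (@lift_item_inj G v)).
  apply: leq_trans (le_s z') _; case: z' => [u|f] /=.
    by rewrite (negPf (valP u)).
  have : lift_edge f \in @lift_edge G v @: setT by apply: imset_f.
  by rewrite eta_edge mem_lift_edge /= => ->.
move: (count_mem z s1) (count_mem z (map _ s)) (count_mem z (map _ (enum S)))
  (count_mem z (map _ (enum (neighbours v :\: S)))).
case: z => [u|e] a b c d /=; last first.
  by rewrite eta_edge; case: (v \in val e) => /=; lia.
(* For [u] in [S], the possible new copy of [u] makes up for the subtracted 1, as [eta (inl u)] is
   positive; for other neighbours the first exchange removes the added 1. *)
rewrite in_setD; have := eta_S u; have [->|uv] := eqVneq u v.
  have -> : (v \in S) = false.
    by apply/negP => /(subsetP S_nbr); rewrite inE adj_irrefl.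
  rewrite !eqxx /=; lia.
rewrite (_ : (inl v == inl u :> item G) = false); last first.
  by apply/eqP=> -[vu]; rewrite vu eqxx in uv.
by case: (u \in S) => /=; last case: (u \in neighbours v) => /=; lia.
Qed.
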